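(* Let $X$ be a non-empty set. The word problem for the free $X$-generated perfect $F$-birestriction monoid $\mathsf{FFBR}_p(X)$ is decidable.
   Context: A birestriction monoid is an algebra $(S;\cdot,{}^*,{}^+,1)$ such that $(S;\cdot,1)$ is a monoid and for all $x,y$: $xx^*=x$, $x^*y^*=y^*x^*$, $(xy^* )^*=x^*y^*$, $x^*y=y(xy)^*$; $x^+x=x$, $x^+y^+=y^+x^+$, $(x^+y)^+=x^+y^+$, $xy^+=(xy)^+x$; $(x^+)^*=x^+$, $(x^* )^+=x^*$. Its projections are $P(S)=\{s^*:s\in S\}=\{s^+:s\in S\}$; $s\le t$ iff $s=et$ for some $e\in P(S)$; $s\mathrel{\sigma}t$ iff $se=te$ for some $e\in P(S)$. An $F$-birestriction monoid is a birestriction monoid in which every $\sigma$-class has a maximum element with respect to $\le$; $s^{\mathfrak m}$ denotes the maximum element of the $\sigma$-class of $s$. $F$-birestriction monoids are regarded as algebras $(S;\cdot,{}^*,{}^+,{}^{\mathfrak m},1)$ of type $(2,1,1,1,0)$. Such a monoid is perfect if it satisfies $x^{\mathfrak m}y^{\mathfrak m}=(xy)^{\mathfrak m}$. Perfect $F$-birestriction monoids form a variety, and $\mathsf{FFBR}_p(X)$ is its free algebra on $X$. The word problem for $\mathsf{FFBR}_p(X)$ is to decide, given two terms over $X$ in the signature $(\cdot,{}^*,{}^+,{}^{\mathfrak m},1)$, whether they have the same value in $\mathsf{FFBR}_p(X)$. Letters of $X$ are treated as formal symbols. *)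

(* Defs.v *)
From HB Require Import structures.
From mathcomp Require Import all_boot generic_quotient.
From mathcomp Require Import boolp.
From Stdlib Require Cantor.

Set Implicit Arguments.
Unset Strict Implicit.
Unset Printing Implicit Defensive.

Local Open Scope quotient_scope.
Local Open Scope group_scope.

(** * Perfect F-birestriction monoids *)

(* [star x] is $x^*$ and [plus x] is $x^+$. *)
HB.mixin Record Monoid_isBirestriction S of Monoid S := {
  star : S -> S;
  plus : S -> S;
  mul_star : forall x, x * star x = x;
  starC : forall x y, star x * star y = star y * star x;
  star_mul_star : forall x y, star (x * star y) = star x * star y;
  star_ample : forall x y, star x * y = y * star (x * y);
  plus_mul : forall x, plus x * x = x;
  plusC : forall x y, plus x * plus y = plus y * plus x;
  plus_plus_mul : forall x y, plus (plus x * y) = plus x * plus y;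
  plus_ample : forall x y, x * plus y = plus (x * y) * x;
  star_plus : forall x, star (plus x) = plus x;
  plus_star : forall x, plus (star x) = star x
}.

#[short(type="birestrictionMonoidType")]
HB.structure Definition BirestrictionMonoid :=
  {S of Monoid_isBirestriction S & Monoid S}.

Definition is_projection (S : birestrictionMonoidType) (e : S) : Prop :=
  exists s : S, e = star s.

Definition nle (S : birestrictionMonoidType) (s t : S) : Prop :=
  exists2 e : S, is_projection e & s = e * t.

Definition sigma (S : birestrictionMonoidType) (s t : S) : Prop :=
  exists2 e : S, is_projection e & s * e = t * e.

Definition is_max_of_sigma_class (S : birestrictionMonoidType) (s m : S) :
    Prop :=
  sigma m s /\ forall t : S, sigma t s -> nle t m.

(* The order is antisymmetric (see [nle_anti]), so [smax s], the element
   $s^{\mathfrak m}$, is determined by the birestriction monoid. *)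
HB.mixin Record BirestrictionMonoid_isF S of BirestrictionMonoid S := {
  smax : S -> S;
  smaxP : forall s : S, is_max_of_sigma_class s (smax s)
}.

#[short(type="fBirestrictionMonoidType")]
HB.structure Definition FBirestrictionMonoid :=
  {S of BirestrictionMonoid_isF S & BirestrictionMonoid S}.

HB.mixin Record FBirestrictionMonoid_isPerfect S of FBirestrictionMonoid S := {
  smaxM : forall x y : S, smax x * smax y = smax (x * y)
}.

#[short(type="perfectFBirestrictionMonoidType")]
HB.structure Definition PerfectFBirestrictionMonoid :=
  {S of FBirestrictionMonoid_isPerfect S & FBirestrictionMonoid S}.

Definition is_pfbr_morphism (S T : perfectFBirestrictionMonoidType)
    (h : S -> T) : Prop :=
  [/\ h 1 = 1, forall x y, h (x * y) = h x * h y,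
      forall x, h (star x) = star (h x), forall x, h (plus x) = plus (h x)
    & forall x, h (smax x) = smax (h x)].

Section BirestrictionTheory.
Variable S : birestrictionMonoidType.
Implicit Types x y s t e f : S.

Lemma projection_plus e : is_projection e <-> exists s, e = plus s.
Proof.
split=> [[s ->]|[s ->]]; first by exists (star s); rewrite plus_star.
by exists (plus s); rewrite star_plus.
Qed.

Lemma starxx x : star x * star x = star x.
Proof. by rewrite -star_mul_star mul_star. Qed.

Lemma star_star x : star (star x) = star x.
Proof. by rewrite -(plus_star x) star_plus. Qed.

Lemma nle_anti s t : nle s t -> nle t s -> s = t.
Proof.
move=> [_ [a ->] es] [_ [b ->] et].
have as_ : star a * s = s by rewrite es mulgA starxx.
by rewrite es et mulgA starC -mulgA as_.
Qed.

Lemma sigma_sym s t : sigma s t -> sigma t s.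
Proof. by move=> [e pe h]; exists e. Qed.

Lemma sigma_trans t s r : sigma s t -> sigma t r -> sigma s r.
Proof.
move=> [_ [a ->] h1] [_ [b ->] h2]; exists (star a * star b).
  by exists (a * star b); rewrite star_mul_star.
by rewrite mulgA h1 -mulgA starC mulgA h2 -mulgA starC.
Qed.

Lemma sigma_mul_star x y : sigma (x * star y) x.
Proof. by exists (star y); [exists y | rewrite -mulgA starxx]. Qed.
End BirestrictionTheory.

Section FBirestrictionTheory.
Variable S : fBirestrictionMonoidType.
Implicit Types x y s t : S.

Lemma sigma_smax s t : sigma s t -> smax s = smax t.
Proof.
move=> st; have [ms Ms] := smaxP s; have [mt Mt] := smaxP t.
apply: nle_anti.
  by apply: Mt; apply: sigma_trans st.
by apply: Ms; apply: sigma_trans (sigma_sym st).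
Qed.

Lemma le_smax s : nle s (smax s).
Proof. by apply: (smaxP s).2; exists (star s) => //; exists s. Qed.

Lemma smax_mul_star s : smax s * star s = s.
Proof.
have [_ [a ->] e] := le_smax s.
by rewrite [RHS]e -[star a]star_star star_ample -e.
Qed.

Lemma plus_mul_smax s : plus s * smax s = s.
Proof.
have [_ [a ->] e] := le_smax s.
by rewrite {1}e -plus_star plus_plus_mul -mulgA plus_mul plus_star -e.
Qed.

Lemma smaxMstar x y : smax (x * star y) = smax x.
Proof. exact/sigma_smax/sigma_mul_star. Qed.
End FBirestrictionTheory.

(** * Terms and the free perfect F-birestriction monoid *)

Inductive term (X : Type) : Type :=
| TVar of X
| TOne
| TMul of term X & term X
| TStar of term X
| TPlus of term X
| TMax of term X.
Arguments TOne {X}.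

Fixpoint term_map (X Y : Type) (f : X -> Y) (t : term X) : term Y :=
  match t with
  | TVar x => TVar (f x)
  | TOne => TOne
  | TMul u v => TMul (term_map f u) (term_map f v)
  | TStar u => TStar (term_map f u)
  | TPlus u => TPlus (term_map f u)
  | TMax u => TMax (term_map f u)
  end.

Fixpoint occurs (X : Type) (x : X) (t : term X) : Prop :=
  match t with
  | TVar y => x = y
  | TOne => False
  | TMul u v => occurs x u \/ occurs x v
  | TStar u | TPlus u | TMax u => occurs x u
  end.

Fixpoint teval (X : Type) (S : perfectFBirestrictionMonoidType) (rho : X -> S)
    (t : term X) : S :=
  match t with
  | TVar x => rho x
  | TOne => 1
  | TMul u v => teval rho u * teval rho v
  | TStar u => star (teval rho u)
  | TPlus u => plus (teval rho u)
  | TMax u => smax (teval rho u)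
  end.

(* The free algebra of the variety is the term algebra modulo the identities
   valid in all its members; [FFBRp_free] is its universal property. *)
Section Free.
Variable X : Type.

HB.instance Definition _ := gen_eqMixin (term X).
HB.instance Definition _ := gen_choiceMixin (term X).

Definition identity_holds (u v : term X) : Prop :=
  forall (S : perfectFBirestrictionMonoidType) (rho : X -> S),
    teval rho u = teval rho v.

Definition term_equiv : rel (term X) := fun u v => `[< identity_holds u v >].

Lemma term_equiv_refl : reflexive term_equiv.
Proof. by move=> u; apply/asboolP. Qed.

Lemma term_equiv_sym : symmetric term_equiv.
Proof.
by move=> u v; apply/asboolP/asboolP => h S rho; rewrite h.
Qed.

Lemma term_equiv_trans : transitive term_equiv.
Proof.
by move=> v u w /asboolP h1 /asboolP h2; apply/asboolP => S rho; rewrite h1.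
Qed.

Canonical term_equiv_rel :=
  EquivRel term_equiv term_equiv_refl term_equiv_sym term_equiv_trans.

Definition FFBRp : Type := {eq_quot term_equiv}.

HB.instance Definition _ := Choice.on FFBRp.

Definition cls (t : term X) : FFBRp := \pi_({eq_quot term_equiv})%qT t.
Definition rep (a : FFBRp) : term X := repr (a : {eq_quot term_equiv}).

Definition FFBRp_gen (x : X) : FFBRp := cls (TVar x).

Lemma repK a : cls (rep a) = a.
Proof. exact: reprK. Qed.

Lemma clsP u v : cls u = cls v <-> identity_holds u v.
Proof.
split=> [/eqP|h]; last by apply/eqP; rewrite eqmodE; apply/asboolP.
by rewrite eqmodE => /asboolP.
Qed.

Lemma rep_cls u : identity_holds (rep (cls u)) u.
Proof. by apply/clsP; rewrite repK. Qed.

Definition FFBRp_mul (a b : FFBRp) : FFBRp := cls (TMul (rep a) (rep b)).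
Definition FFBRp_one : FFBRp := cls TOne.
Definition FFBRp_star (a : FFBRp) : FFBRp := cls (TStar (rep a)).
Definition FFBRp_plus (a : FFBRp) : FFBRp := cls (TPlus (rep a)).
Definition FFBRp_smax (a : FFBRp) : FFBRp := cls (TMax (rep a)).

Lemma FFBRp_mulE u v : FFBRp_mul (cls u) (cls v) = cls (TMul u v).
Proof. by apply/clsP => S rho /=; rewrite !rep_cls. Qed.
Lemma FFBRp_starE u : FFBRp_star (cls u) = cls (TStar u).
Proof. by apply/clsP => S rho /=; rewrite !rep_cls. Qed.
Lemma FFBRp_plusE u : FFBRp_plus (cls u) = cls (TPlus u).
Proof. by apply/clsP => S rho /=; rewrite !rep_cls. Qed.
Lemma FFBRp_smaxE u : FFBRp_smax (cls u) = cls (TMax u).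
Proof. by apply/clsP => S rho /=; rewrite !rep_cls. Qed.

Let opE := (FFBRp_mulE, FFBRp_starE, FFBRp_plusE, FFBRp_smaxE).

Fact FFBRp_mulA : associative FFBRp_mul.
Proof.
move=> a b c; rewrite -(repK a) -(repK b) -(repK c) !opE.
by apply/clsP => S rho /=; rewrite mulgA.
Qed.

Fact FFBRp_mul1 : left_id FFBRp_one FFBRp_mul.
Proof.
by move=> a; rewrite -(repK a) !opE; apply/clsP => S rho /=; rewrite mul1g.
Qed.

Fact FFBRp_mulr1 : right_id FFBRp_one FFBRp_mul.
Proof.
by move=> a; rewrite -(repK a) !opE; apply/clsP => S rho /=; rewrite mulg1.
Qed.

HB.instance Definition _ :=
  isMonoid.Build FFBRp FFBRp_mulA FFBRp_mul1 FFBRp_mulr1.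

Fact FFBRp_mul_star : forall a, FFBRp_mul a (FFBRp_star a) = a.
Proof.
move=> a; rewrite -(repK a) !opE.
by apply/clsP => S rho; apply: mul_star.
Qed.

Fact FFBRp_starC : forall a b, FFBRp_mul (FFBRp_star a) (FFBRp_star b) =
    FFBRp_mul (FFBRp_star b) (FFBRp_star a).
Proof.
move=> a b; rewrite -(repK a) -(repK b) !opE.
by apply/clsP => S rho; apply: starC.
Qed.

Fact FFBRp_star_mul_star : forall a b, FFBRp_star (FFBRp_mul a (FFBRp_star b)) =
    FFBRp_mul (FFBRp_star a) (FFBRp_star b).
Proof.
move=> a b; rewrite -(repK a) -(repK b) !opE.
by apply/clsP => S rho; apply: star_mul_star.
Qed.

Fact FFBRp_star_ample : forall a b, FFBRp_mul (FFBRp_star a) b =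
    FFBRp_mul b (FFBRp_star (FFBRp_mul a b)).
Proof.
move=> a b; rewrite -(repK a) -(repK b) !opE.
by apply/clsP => S rho; apply: star_ample.
Qed.

Fact FFBRp_plus_mul : forall a, FFBRp_mul (FFBRp_plus a) a = a.
Proof.
move=> a; rewrite -(repK a) !opE.
by apply/clsP => S rho; apply: plus_mul.
Qed.

Fact FFBRp_plusC : forall a b, FFBRp_mul (FFBRp_plus a) (FFBRp_plus b) =
    FFBRp_mul (FFBRp_plus b) (FFBRp_plus a).
Proof.
move=> a b; rewrite -(repK a) -(repK b) !opE.
by apply/clsP => S rho; apply: plusC.
Qed.

Fact FFBRp_plus_plus_mul : forall a b, FFBRp_plus (FFBRp_mul (FFBRp_plus a) b) =
    FFBRp_mul (FFBRp_plus a) (FFBRp_plus b).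
Proof.
move=> a b; rewrite -(repK a) -(repK b) !opE.
by apply/clsP => S rho; apply: plus_plus_mul.
Qed.

Fact FFBRp_plus_ample : forall a b, FFBRp_mul a (FFBRp_plus b) =
    FFBRp_mul (FFBRp_plus (FFBRp_mul a b)) a.
Proof.
move=> a b; rewrite -(repK a) -(repK b) !opE.
by apply/clsP => S rho; apply: plus_ample.
Qed.

Fact FFBRp_star_plus : forall a, FFBRp_star (FFBRp_plus a) = FFBRp_plus a.
Proof.
move=> a; rewrite -(repK a) !opE.
by apply/clsP => S rho; apply: star_plus.
Qed.

Fact FFBRp_plus_star : forall a, FFBRp_plus (FFBRp_star a) = FFBRp_star a.
Proof.
move=> a; rewrite -(repK a) !opE.
by apply/clsP => S rho; apply: plus_star.
Qed.

HB.instance Definition _ :=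
  Monoid_isBirestriction.Build FFBRp
    FFBRp_mul_star FFBRp_starC FFBRp_star_mul_star
    FFBRp_star_ample FFBRp_plus_mul FFBRp_plusC
    FFBRp_plus_plus_mul FFBRp_plus_ample FFBRp_star_plus
    FFBRp_plus_star.

Fact FFBRp_smaxP (a : FFBRp) : is_max_of_sigma_class a (FFBRp_smax a).
Proof.
rewrite -(repK a) FFBRp_smaxE; split.
  exists (star (cls (rep a))); first by exists (cls (rep a)).
  rewrite mul_star [star _]FFBRp_starE [_ * _]FFBRp_mulE.
  by apply/clsP => S rho; apply: smax_mul_star.
move=> b [_ [c ->]]; rewrite -(repK b) -(repK c).
rewrite [star _]FFBRp_starE [_ * _]FFBRp_mulE [RHS]FFBRp_mulE => /clsP h.
exists (plus (cls (rep b))).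
  by exists (plus (cls (rep b))); rewrite star_plus.
rewrite [plus _]FFBRp_plusE [RHS]FFBRp_mulE; apply/clsP => S rho /=.
have /= e := h S rho.
by rewrite -(smaxMstar _ (teval rho (rep c))) -e smaxMstar plus_mul_smax.
Qed.

HB.instance Definition _ := BirestrictionMonoid_isF.Build FFBRp FFBRp_smaxP.

Fact FFBRp_smaxM (a b : FFBRp) :
  FFBRp_mul (FFBRp_smax a) (FFBRp_smax b) = FFBRp_smax (FFBRp_mul a b).
Proof.
rewrite -(repK a) -(repK b) !opE.
by apply/clsP => S rho; apply: smaxM.
Qed.

HB.instance Definition _ :=
  FBirestrictionMonoid_isPerfect.Build FFBRp FFBRp_smaxM.

Lemma teval_FFBRp_gen (t : term X) : teval FFBRp_gen t = cls t.
Proof.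
elim: t => //= [u -> v ->|u ->|u ->|u ->];
  [exact: FFBRp_mulE | exact: FFBRp_starE | exact: FFBRp_plusE
  | exact: FFBRp_smaxE].
Qed.

Theorem FFBRp_free (S : perfectFBirestrictionMonoidType) (rho : X -> S) :
  exists! h : FFBRp -> S,
    is_pfbr_morphism h /\ forall x, h (FFBRp_gen x) = rho x.
Proof.
exists (fun a => teval rho (rep a)); split.
  by split=> [|x]; [split=> *|]; exact: rep_cls.
move=> h [[h1 hM hs hp hm] hg]; apply/funext => a.
rewrite -[a in RHS]repK -teval_FFBRp_gen.
by elim: (rep a) => //= [u -> v ->|u ->|u ->|u ->];
  rewrite ?hM ?hs ?hp ?hm.
Qed.
End Free.

(** * Decidability *)

Local Open Scope nat_scope.

(* The total recursive functions: the least class containing the zero,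
   successor and projection functions and closed under composition, primitive
   recursion and minimization of regular functions.  The recursion variable and
   the minimization variable are the first argument. *)
Inductive recursive : forall k : nat, (k.-tuple nat -> nat) -> Prop :=
| rec_zero k :
    recursive (fun _ : k.-tuple nat => 0)
| rec_succ :
    recursive (fun v : 1.-tuple nat => (thead v).+1)
| rec_proj k (i : 'I_k) :
    recursive (fun v : k.-tuple nat => tnth v i)
| rec_comp k n (f : n.-tuple nat -> nat) (g : 'I_n -> k.-tuple nat -> nat) :
    recursive f -> (forall i, recursive (g i)) ->
    recursive (fun v => f [tuple g i v | i < n])
| rec_prim k (f : k.-tuple nat -> nat) (g : k.+2.-tuple nat -> nat)
    (h : k.+1.-tuple nat -> nat) :
    recursive f -> recursive g ->
    (forall v, h (cons_tuple 0 v) = f v) ->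
    (forall n v, h (cons_tuple n.+1 v) =
                 g (cons_tuple n (cons_tuple (h (cons_tuple n v)) v))) ->
    recursive h
| rec_mu k (f : k.+1.-tuple nat -> nat) (h : k.-tuple nat -> nat) :
    recursive f ->
    (forall v, f (cons_tuple (h v) v) = 0) ->
    (forall v m, m < h v -> f (cons_tuple m v) <> 0) ->
    recursive h.

(* Goedel numbering of terms whose letters are the formal symbols
   $x_0, x_1, \dots$ *)
Fixpoint code (t : term nat) : nat :=
  match t with
  | TVar n => Cantor.to_nat (0, n)
  | TOne => Cantor.to_nat (1, 0)
  | TMul u v => Cantor.to_nat (2, Cantor.to_nat (code u, code v))
  | TStar u => Cantor.to_nat (3, code u)
  | TPlus u => Cantor.to_nat (4, code u)
  | TMax u => Cantor.to_nat (5, code u)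
  end.

Lemma code_inj : injective code.
Proof.
have J a b c d : Cantor.to_nat (a, b) = Cantor.to_nat (c, d) ->
  a = c /\ b = d by move=> h; case: (Cantor.to_nat_inj _ _ h).
elim=> [n||u IHu v IHv|u IHu|u IHu|u IHu] [m||u' v'|u'|u'|u'] e;
  have [//= _] := J _ _ _ _ e.
- by move=> ->.
- by move=> /J [/IHu -> /IHv ->].
- by move=> /IHu ->.
- by move=> /IHu ->.
- by move=> /IHu ->.
Qed.

Definition injective_on_letters (X : Type) (nu : X -> nat) (u v : term X) :
    Prop :=
  forall x y : X, occurs x u \/ occurs x v -> occurs y u \/ occurs y v ->
    nu x = nu y -> x = y.

(* As letters are formal symbols and a pair of terms contains finitely many of
   them, a pair is presented to the algorithm by any assignment [nu] of symbols
   $x_0, x_1, \dots$ to letters that separates the letters occurring in it;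
   thus [X] need be neither countable nor effectively presented. *)
Definition decidable_word_problem (X : Type)
    (F : perfectFBirestrictionMonoidType) (gen : X -> F) : Prop :=
  exists2 d : 2.-tuple nat -> nat, recursive d &
    forall (u v : term X) (nu : X -> nat), injective_on_letters nu u v ->
      d [tuple code (term_map nu u); code (term_map nu v)]
        = nat_of_bool `[< teval gen u = teval gen v >].

(* Main.v *)
(* A term over x_0, x_1, ... is evaluated to a pair (A, w): its value modulo
   sigma, a word w in the free monoid, and a Munn tree A, a finite set of edges
   of the Cayley graph of the free group, with labels x and x^m. The operations
   are (A, w)(B, v) = (A \cup wB, wv), (A, w)^* = (w^-1 A, 1), (A, w)^+ = (A, 1)
   and (A, w)^m = (path of w, w). Two terms agree in all perfect F-birestriction
   monoids iff their pairs agree. Indeed, such pairs form a perfect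
   F-birestriction monoid. Conversely, x^m acts on the projections of any such
   monoid S by a partial isomorphism e |-> (x^m e)^+ with inverse
   e |-> (e x^m)^*, so every edge names a projection of S, and the value of a
   term is the product of the projections of its edges and of the letters x^m
   of w. The pair is computed from the code of the term by course-of-values
   recursion. *)
From mathcomp Require Import all_boot boolp classical_sets zify.
From HB Require Import structures.
From Stdlib Require Cantor.
Require Import Defs.

Set Implicit Arguments.
Unset Strict Implicit.
Unset Printing Implicit Defensive.

(** * Closure properties of recursive functions *)

Section RecursiveClosure.
Variable k : nat.
Implicit Types f g : k.-tuple nat -> nat.

Lemma recursive_comp1 (h : nat -> nat) f :
  recursive (fun v : 1.-tuple nat => h (thead v)) -> recursive f ->
  recursive (fun v => h (f v)).
Proof.
move=> rh rf.
have := rec_comp (g := fun (_ : 'I_1) v => f v) rh (fun _ => rf).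
by congr recursive; apply/funext => v; rewrite /thead tnth_mktuple.
Qed.

Lemma recursive_comp2 (h : nat -> nat -> nat) f g :
  recursive (fun v : 2.-tuple nat => h (tnth v ord0) (tnth v ord_max)) ->
  recursive f -> recursive g ->
  recursive (fun v => h (f v) (g v)).
Proof.
move=> rh rf rg.
have rfg (i : 'I_2) : recursive (if i == ord0 then f else g).
  by case: (i == ord0).
have := rec_comp rh rfg.
by congr recursive; apply/funext => v; rewrite !tnth_mktuple.
Qed.

Lemma recursive_comp3 (h : nat -> nat -> nat -> nat) f1 f2 f3 :
  recursive (fun v : 3.-tuple nat =>
    h (tnth v ord0) (tnth v (inord 1)) (tnth v ord_max)) ->
  recursive f1 -> recursive f2 -> recursive f3 ->
  recursive (fun v => h (f1 v) (f2 v) (f3 v)).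
Proof.
move=> rh r1 r2 r3.
have rf (i : 'I_3) :
    recursive (if i == ord0 then f1 else if i == ord_max then f3 else f2).
  by case: (i == ord0); case: (i == ord_max).
have := rec_comp rh rf.
congr recursive; apply/funext => v; rewrite !tnth_mktuple.
by rewrite -!val_eqE /= !inordK.
Qed.

Lemma recursive_succ f : recursive f -> recursive (fun v => (f v).+1).
Proof. exact: recursive_comp1 rec_succ. Qed.

Lemma recursive_const n : recursive (fun _ : k.-tuple nat => n).
Proof. by elim: n => [|n IHn]; [exact: rec_zero | exact: recursive_succ]. Qed.
End RecursiveClosure.

Lemma recursive_thead : recursive (fun v : 1.-tuple nat => thead v).
Proof. exact: rec_proj. Qed.

Lemma recursive_nat_rect (a : nat) (g : nat -> nat -> nat) :
  recursive (fun v : 2.-tuple nat => g (tnth v ord0) (tnth v ord_max)) ->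
  recursive (fun v : 1.-tuple nat => nat_rect (fun=> nat) a g (thead v)).
Proof.
move=> rg.
apply: (rec_prim (f := fun=> a)
  (g := fun v => g (tnth v ord0) (tnth v ord_max))).
- exact: recursive_const.
- exact: rg.
- by [].
- by move=> n v; rewrite !(tnth_nth 0).
Qed.

(** The parameter [z] is carried along unchanged, so that an iterated step can still consult the
    original argument. *)
Lemma recursive_iter k (g : nat -> nat -> nat) (n a z : k.-tuple nat -> nat) :
  recursive (fun v : 2.-tuple nat => g (tnth v ord0) (tnth v ord_max)) ->
  recursive n -> recursive a -> recursive z ->
  recursive (fun v => iter (n v) (fun r => g r (z v)) (a v)).
Proof.
move=> rg rn ra rz.
apply: (recursive_comp3 (h := fun n a z => iter n (fun r => g r z) a)) => //.
(* The step receives the counter, the previous value, [a] and [z] in this order and reads only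
   positions 1 and 3. *)
apply: (rec_prim (f := fun v : 2.-tuple nat => tnth v ord0)
  (g := fun v : 4.-tuple nat => g (tnth v (inord 1)) (tnth v ord_max))).
- exact: rec_proj.
- by apply: recursive_comp2 => //; exact: rec_proj.
- by move=> v; rewrite !(tnth_nth 0) /= inordK.
- by move=> m v; rewrite !(tnth_nth 0) /= !inordK.
Qed.

Lemma recursive_pred k (f : k.-tuple nat -> nat) :
  recursive f -> recursive (fun v => (f v).-1).
Proof.
apply: recursive_comp1.
have := @recursive_nat_rect 0 (fun n _ => n) (rec_proj _).
by congr recursive; apply/funext => v; case: (thead v).
Qed.

Lemma recursive_add k (f g : k.-tuple nat -> nat) :
  recursive f -> recursive g -> recursive (fun v => f v + g v).
Proof.
move=> rf rg.
have := recursive_iter (g := fun r _ => r.+1)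
  (recursive_succ (rec_proj ord0)) rf rg rg.
by congr recursive; apply/funext => v; elim: (f v) => //= n ->.
Qed.

Lemma recursive_sub k (f g : k.-tuple nat -> nat) :
  recursive f -> recursive g -> recursive (fun v => f v - g v).
Proof.
move=> rf rg.
have := recursive_iter (g := fun r _ => r.-1)
  (recursive_pred (rec_proj ord0)) rg rf rf.
congr recursive; apply/funext => v.
by elim: (g v) => [|n /= ->]; rewrite ?subn0 ?subnS.
Qed.

Lemma recursive_if0 k (f g h : k.-tuple nat -> nat) :
  recursive f -> recursive g -> recursive h ->
  recursive (fun v => if f v is 0 then g v else h v).
Proof.
apply: (recursive_comp3 (h := fun n a b => if n is 0 then a else b)).
apply: (rec_prim (f := fun v : 2.-tuple nat => tnth v ord0)
  (g := fun v : 4.-tuple nat => tnth v ord_max)).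
- exact: rec_proj.
- exact: rec_proj.
- by move=> v; rewrite !(tnth_nth 0) /= inordK.
- by move=> n v; rewrite !(tnth_nth 0).
Qed.

(** * Cantor pairing and its inverses are recursive *)

(** Triangular numbers, written as the very recursion into which [Cantor.to_nat] unfolds, so that
    [cantor_pairE] holds by conversion. *)
Definition triangle (n : nat) : nat :=
  nat_rect (fun=> nat) 0 (fun i m => i.+1 + m) n.

Lemma triangleS n : triangle n.+1 = n.+1 + triangle n.
Proof. by []. Qed.

Lemma leq_triangle n : n <= triangle n.
Proof. by case: n => // n; exact: leq_addr. Qed.

Lemma cantor_pairE x y : Cantor.to_nat (x, y) = y + triangle (y + x).
Proof. by []. Qed.

Lemma recursive_triangle k (f : k.-tuple nat -> nat) :
  recursive f -> recursive (fun v => triangle (f v)).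
Proof.
apply: recursive_comp1; apply: recursive_nat_rect.
by apply: recursive_add; [apply: recursive_succ|]; exact: rec_proj.
Qed.

Lemma recursive_pair k (f g : k.-tuple nat -> nat) :
  recursive f -> recursive g ->
  recursive (fun v => Cantor.to_nat (f v, g v)).
Proof.
move=> rf rg; apply: recursive_add => //.
exact/recursive_triangle/recursive_add.
Qed.

(* The index x + y of the Cantor diagonal on which n = <x, y> lies. *)
Definition diagonal (n : nat) : nat :=
  nat_rect (fun=> nat) 0
    (fun n d => if triangle d.+1 - n.+1 is 0 then d.+1 else d) n.

Lemma recursive_diagonal k (f : k.-tuple nat -> nat) :
  recursive f -> recursive (fun v => diagonal (f v)).
Proof.
have rS n (i : 'I_n) := recursive_succ (rec_proj i).
apply: recursive_comp1; apply: recursive_nat_rect.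
apply: recursive_if0 => //; last exact: rec_proj.
by apply: recursive_sub => //; exact: recursive_triangle.
Qed.

(** The intervals from [triangle d] to [triangle d.+1] partition the numbers. The recursion keeps
    [n] in the interval of [diagonal n], while y + [triangle (x + y)] lies in the interval of x + y
    because y <= x + y. *)
Lemma diagonal_pair x y : diagonal (Cantor.to_nat (x, y)) = x + y.
Proof.
have bound n : triangle (diagonal n) <= n < triangle (diagonal n).+1.
  elim: n => // n; rewrite -/(diagonal n.+1).
  have -> : diagonal n.+1 = if triangle (diagonal n).+1 - n.+1 is 0
    then (diagonal n).+1 else diagonal n by [].
  move: (diagonal n) => d.
  case e : (triangle d.+1 - n.+1) => [|m]; rewrite !triangleS in e *; lia.
have mono a b : a <= b -> triangle a <= triangle b.
  by move=> /subnK <-; elim: (b - a) => // n IH; rewrite addSn triangleS; lia.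
have := bound (Cantor.to_nat (x, y)); move: (diagonal _) => d.
rewrite cantor_pairE.
move=> /andP[h1 h2].
case: (ltngtP d (x + y)) => // h; rewrite addnC in h.
  by have := mono _ _ h; lia.
by have := mono _ _ h; rewrite triangleS; lia.
Qed.

Lemma diagonalE n : diagonal n = (Cantor.of_nat n).1 + (Cantor.of_nat n).2.
Proof.
by case e : (Cantor.of_nat n) => [x y]; rewrite -(Cantor.cancel_to_of n) e
  diagonal_pair.
Qed.

(** A code on diagonal d is y + [triangle d], so subtracting the triangular number leaves y; the
    first component is then d - y. *)
Lemma recursive_unpair2 k (f : k.-tuple nat -> nat) :
  recursive f -> recursive (fun v => (Cantor.of_nat (f v)).2).
Proof.
move=> rf.
have := recursive_sub rf (recursive_triangle (recursive_diagonal rf)).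
congr recursive; apply/funext => v; rewrite diagonalE.
case e : (Cantor.of_nat _) => [x y] /=.
by rewrite -(Cantor.cancel_to_of (f v)) e cantor_pairE (addnC x) addnK.
Qed.

Lemma recursive_unpair1 k (f : k.-tuple nat -> nat) :
  recursive f -> recursive (fun v => (Cantor.of_nat (f v)).1).
Proof.
move=> rf.
have := recursive_sub (recursive_diagonal rf) (recursive_unpair2 rf).
by congr recursive; apply/funext => v; rewrite diagonalE addnK.
Qed.

(** * Computable functions between encoded types *)

Class encodable (T : Type) := Encodable {
  encode : T -> nat;
  encode_inj : injective encode
}.

#[export] Instance nat_encodable : encodable nat := Encodable (@inj_id nat).

Lemma nat_of_bool_inj : injective nat_of_bool.
Proof. by case=> [] []. Qed.

#[export] Instance bool_encodable : encodable bool := Encodable nat_of_bool_inj.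

#[export] Instance term_encodable : encodable (term nat) := Encodable code_inj.

Section ProdEncodable.
Context {T U : Type} {eT : encodable T} {eU : encodable U}.

Definition encode_prod (p : T * U) : nat :=
  Cantor.to_nat (encode p.1, encode p.2).

Lemma encode_prod_inj : injective encode_prod.
Proof.
move=> [a b] [c d] /Cantor.to_nat_inj [e1 e2].
by rewrite (encode_inj e1) (encode_inj e2).
Qed.

#[export] Instance prod_encodable : encodable (T * U) :=
  Encodable encode_prod_inj.
End ProdEncodable.

Section SeqEncodable.
Context {T : Type} {eT : encodable T}.

(** The successor keeps nonempty lists away from 0: case analysis becomes a zero test, and the
    predecessor codes the pair of head and tail. *)
Fixpoint encode_seq (s : seq T) : nat :=
  if s is x :: s' then (Cantor.to_nat (encode x, encode_seq s')).+1 else 0.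

Lemma encode_seq_inj : injective encode_seq.
Proof.
elim=> [|x s IH] [|y r] // /succn_inj e.
have [e1 e2] := Cantor.to_nat_inj _ _ e.
by rewrite (encode_inj e1) (IH _ e2).
Qed.

#[export] Instance seq_encodable : encodable (seq T) :=
  Encodable encode_seq_inj.

(** Supplies the number of steps for folds: the code of a list bounds its length. *)
Lemma size_encode (s : seq T) : size s <= encode s.
Proof.
rewrite /encode /=; elim: s => // x s IH.
have h : forall a b, b <= Cantor.to_nat (a, b) by move=> a b; exact: leq_addr.
exact: leq_trans IH (h _ _).
Qed.
End SeqEncodable.

(** The realizer is constrained on codes only and takes arbitrary values elsewhere. *)
Definition computable {A B : Type} {eA : encodable A} {eB : encodable B}
    (f : A -> B) : Prop :=
  exists2 F : nat -> nat, recursive (fun v : 1.-tuple nat => F (thead v)) &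
    forall a, F (encode a) = encode (f a).

Section Computable.
Context {A B C : Type}.
Context {eA : encodable A} {eB : encodable B} {eC : encodable C}.

Lemma eq_computable (f g : A -> B) : f =1 g -> computable f -> computable g.
Proof. by move=> /funext ->. Qed.

Lemma computable_id : computable (fun a : A => a).
Proof. by exists id => //; exact: recursive_thead. Qed.

Lemma computable_const (b : B) : computable (fun _ : A => b).
Proof. by exists (fun=> encode b) => //; exact: recursive_const. Qed.

Lemma computable_comp (g : B -> C) (f : A -> B) :
  computable g -> computable f -> computable (fun a => g (f a)).
Proof.
move=> [G rG hG] [F rF hF]; exists (fun n => G (F n)).
  exact: recursive_comp1 rG rF.
by move=> a; rewrite hF hG.
Qed.

Lemma computable_pair (f : A -> B) (g : A -> C) :
  computable f -> computable g -> computable (fun a => (f a, g a)).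
Proof.
move=> [F rF hF] [G rG hG]; exists (fun n => Cantor.to_nat (F n, G n)).
  exact: recursive_pair.
by move=> a; rewrite hF hG.
Qed.

Lemma computable_fst (f : A -> B * C) :
  computable f -> computable (fun a => (f a).1).
Proof.
move=> [F rF hF]; exists (fun n => (Cantor.of_nat (F n)).1).
  exact: recursive_unpair1.
by move=> a; rewrite hF Cantor.cancel_of_to.
Qed.

Lemma computable_snd (f : A -> B * C) :
  computable f -> computable (fun a => (f a).2).
Proof.
move=> [F rF hF]; exists (fun n => (Cantor.of_nat (F n)).2).
  exact: recursive_unpair2.
by move=> a; rewrite hF Cantor.cancel_of_to.
Qed.

Lemma computable_encode (f : A -> B) :
  computable f -> computable (fun a => encode (f a)).
Proof. by move=> [F rF hF]; exists F. Qed.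

Lemma computable_if (b : A -> bool) (f g : A -> B) :
  computable b -> computable f -> computable g ->
  computable (fun a => if b a then f a else g a).
Proof.
move=> [F rF hF] [G rG hG] [H rH hH].
exists (fun n => if F n is 0 then H n else G n); first exact: recursive_if0.
by move=> a; rewrite hF hG hH; case: (b a).
Qed.

Lemma computable_iter (n : A -> nat) (g : B * A -> B) (i : A -> B) :
  computable n -> computable g -> computable i ->
  computable (fun a => iter (n a) (fun r => g (r, a)) (i a)).
Proof.
move=> [N rN hN] [G rG hG] [I rI hI].
exists (fun m => iter (N m) (fun r => G (Cantor.to_nat (r, m))) (I m)).
  apply: (recursive_iter (g := fun r m => G (Cantor.to_nat (r, m)))) => //.
    by apply: (recursive_comp1 (h := G)) => //; apply: recursive_pair;
      exact: rec_proj.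
  exact: recursive_thead.
move=> a; rewrite hN hI; elim: (n a) => //= m ->.
exact: (hG (_, a)).
Qed.

Lemma computable_cons (f : A -> B) (g : A -> seq B) :
  computable f -> computable g -> computable (fun a => f a :: g a).
Proof.
move=> [F rF hF] [G rG hG]; exists (fun n => (Cantor.to_nat (F n, G n)).+1).
  exact/recursive_succ/recursive_pair.
by move=> a; rewrite hF hG.
Qed.

Lemma computable_seq_case (l : A -> seq B) (f : A -> C)
    (g : B * seq B * A -> C) :
  computable l -> computable f -> computable g ->
  computable (fun a => if l a is x :: s then g (x, s, a) else f a).
Proof.
move=> [L rL hL] [F rF hF] [G rG hG].
exists (fun n => if L n is 0 then F n else G (Cantor.to_nat ((L n).-1, n))).
  apply: recursive_if0 => //; apply: (recursive_comp1 (h := G)) => //.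
  by apply: recursive_pair; [exact: recursive_pred | exact: recursive_thead].
move=> a; rewrite hL hF; case: (l a) => //= x s.
exact: (hG (x, s, a)).
Qed.
End Computable.

Ltac computability := repeat match goal with
  | _ => assumption
  | |- computable (fun a => a) => exact: computable_id
  | |- computable fst => exact: (computable_fst computable_id)
  | |- computable snd => exact: (computable_snd computable_id)
  | |- computable (fun=> ?b) => exact: computable_const
  | |- computable (fun a => (@?f a, @?g a)) =>
      apply: (@computable_pair _ _ _ _ _ _ f g)
  | |- computable (fun a => (@?f a).1) => apply: (@computable_fst _ _ _ _ _ _ f)
  | |- computable (fun a => (@?f a).2) => apply: (@computable_snd _ _ _ _ _ _ f)
  | |- computable (fun a => @?f a :: @?g a) =>
      apply: (@computable_cons _ _ _ _ f g)
  end.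

Lemma computable_succ {A : Type} {eA : encodable A} (f : A -> nat) :
  computable f -> computable (fun a => (f a).+1).
Proof.
move=> [F rF hF]; exists (fun n => (F n).+1); first exact: recursive_succ.
by move=> a; rewrite hF.
Qed.

Lemma computable_sub {A : Type} {eA : encodable A} (f g : A -> nat) :
  computable f -> computable g -> computable (fun a => f a - g a).
Proof.
move=> [F rF hF] [G rG hG]; exists (fun n => F n - G n).
  exact: recursive_sub.
by move=> a; rewrite hF hG.
Qed.

(** Numbers code themselves, so a number is already the code of the pair it unpacks to, and the
    realizer does not change. *)
Lemma computable_unpair {A : Type} {eA : encodable A} (f : A -> nat) :
  computable f -> computable (fun a => Cantor.of_nat (f a)).
Proof.
move=> [F rF hF]; exists F => // a; rewrite hF /encode /= /encode_prod.
by rewrite -surjective_pairing Cantor.cancel_to_of.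
Qed.

(** With truncated subtraction, m = n iff (m - n) + (n - m) = 0; injectivity of the encoding reduces
    equality to equality of codes. *)
Lemma computable_eq {A : Type} {B : eqType} {eA : encodable A}
    {eB : encodable B} (f g : A -> B) :
  computable f -> computable g -> computable (fun a => f a == g a).
Proof.
move=> [F rF hF] [G rG hG].
exists (fun n => if (F n - G n) + (G n - F n) is 0 then 1 else 0).
  apply: recursive_if0; [|exact: recursive_const..].
  by apply: recursive_add; exact: recursive_sub.
move=> a; rewrite hF hG -(inj_eq encode_inj) eqn_leq -!subn_eq0 -addn_eq0.
by case: (_ + _).
Qed.

Lemma computable_andb {A : Type} {eA : encodable A} (f g : A -> bool) :
  computable f -> computable g -> computable (fun a => f a && g a).
Proof.
by move=> cf cg; apply: computable_if => //; exact: computable_const.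
Qed.

(** * Folds and the usual operations on coded lists *)

Section ComputableSeq.
Context {A B C : Type}.
Context {eA : encodable A} {eB : encodable B} {eC : encodable C}.

(** The fold is an iteration on pairs of remaining list and accumulator. The code of the list serves
    as the number of steps: it is at least the length, and the surplus steps fix a pair whose list
    is empty. *)
Lemma computable_foldl (l : A -> seq B) (i : A -> C) (g : C * B * A -> C) :
  computable l -> computable i -> computable g ->
  computable (fun a => foldl (fun r x => g (r, x, a)) (i a) (l a)).
Proof.
move=> cl ci cg.
pose step (p : (seq B * C) * A) : seq B * C :=
  if p.1.1 is x :: s then (s, g (p.1.2, x, p.2)) else p.1.
have cstep : computable step.
  apply: (computable_seq_case (l := fun p => p.1.1) (f := fun p => p.1)
    (g := fun q => (q.1.2, g (q.2.1.2, q.1.1, q.2.2)))).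
  - computability.
  - computability.
  - apply: computable_pair; first by computability.
    by apply: (computable_comp (g := g)) => //; computability.
apply: eq_computable (computable_snd (computable_iter
  (n := fun a => encode (l a)) (i := fun a => (l a, i a))
  (computable_encode cl) cstep
  (computable_pair cl ci))) => a.
have := @size_encode _ eB (l a); move: (encode (l a)) => n.
elim: (l a) (i a) n => [|x s IH] r n /=.
  move=> _; suff -> : iter n (fun p => step (p, a)) ([::], r) = ([::], r) by [].
  by elim: n => //= n ->.
by case: n => // n; rewrite ltnS => h; rewrite iterSr /= IH.
Qed.
End ComputableSeq.

Section ComputableSeqOps.
Context {A B C : Type}.
Context {eA : encodable A} {eB : encodable B} {eC : encodable C}.

Lemma computable_behead (l : A -> seq B) :
  computable l -> computable (fun a => behead (l a)).
Proof.
move=> cl; have := computable_seq_case (l := l) (f := fun=> [::])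
  (g := fun q => q.1.2) cl (computable_const _).
by apply; computability.
Qed.

Lemma computable_head (b : B) (l : A -> seq B) :
  computable l -> computable (fun a => head b (l a)).
Proof.
move=> cl; have := computable_seq_case (l := l) (f := fun=> b)
  (g := fun q => q.1.1) cl (computable_const _).
by apply; computability.
Qed.

Lemma computable_rev (l : A -> seq B) :
  computable l -> computable (fun a => rev (l a)).
Proof.
move=> cl; apply: (@eq_computable _ _ _ _
  (fun a => foldl (fun r x => x :: r) [::] (l a))).
  by move=> a; rewrite /rev; elim: (l a) [::] => //= x s IH r.
by apply: (computable_foldl (i := fun=> [::])
  (g := fun q : seq B * B * A => q.1.2 :: q.1.1)); computability.
Qed.

Lemma computable_foldr (l : A -> seq B) (i : A -> C) (g : C * B * A -> C) :
  computable l -> computable i -> computable g ->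
  computable (fun a => foldr (fun x r => g (r, x, a)) (i a) (l a)).
Proof.
move=> cl ci cg.
apply: eq_computable (computable_foldl (computable_rev cl) ci cg).
by move=> a; rewrite foldl_rev.
Qed.
End ComputableSeqOps.

Section ComputableSeqTheory.
Context {A B C : Type}.
Context {eA : encodable A} {eB : encodable B} {eC : encodable C}.

Lemma computable_map (l : A -> seq B) (g : B * A -> C) :
  computable l -> computable g ->
  computable (fun a => [seq g (x, a) | x <- l a]).
Proof.
move=> cl cg; apply: (computable_foldr (i := fun=> [::])
  (g := fun q : seq C * B * A => g (q.1.2, q.2) :: q.1.1)) => //.
  by computability.
apply: computable_cons; last by computability.
by apply: (computable_comp (g := g)) => //; computability.
Qed.

Lemma computable_cat (l m : A -> seq B) :
  computable l -> computable m -> computable (fun a => l a ++ m a).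
Proof.
move=> cl cm; apply: (@eq_computable _ _ _ _
  (fun a => foldr (fun x r => x :: r) (m a) (l a))).
  by move=> a; elim: (l a) => //= x s ->.
by apply: (computable_foldr (g := fun q : seq B * B * A => q.1.2 :: q.1.1));
  computability.
Qed.

Lemma computable_all (l : A -> seq B) (p : B * A -> bool) :
  computable l -> computable p ->
  computable (fun a => all (fun x => p (x, a)) (l a)).
Proof.
move=> cl cp; apply: (computable_foldr (i := fun=> true)
  (g := fun q : bool * B * A => p (q.1.2, q.2) && q.1.1)) => //.
  by computability.
apply: computable_andb; last by computability.
by apply: (computable_comp (g := p)) => //; computability.
Qed.

Lemma computable_size (l : A -> seq B) :
  computable l -> computable (fun a => size (l a)).
Proof.
move=> cl; apply: (computable_foldr (i := fun=> 0)
  (g := fun q : nat * B * A => q.1.1.+1)) => //; first by computability.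
by apply: computable_succ; computability.
Qed.

Lemma computable_nth (b : B) (l : A -> seq B) (n : A -> nat) :
  computable l -> computable n -> computable (fun a => nth b (l a) (n a)).
Proof.
move=> cl cn.
have cb : computable (fun q : seq B * A => behead q.1).
  by apply: computable_behead; computability.
apply: eq_computable (computable_head b (computable_iter cn cb cl)) => a.
elim: (n a) (l a) => [|m IH] [|x s] //=; rewrite -iterS iterSr IH //.
by rewrite nth_nil.
Qed.
End ComputableSeqTheory.

Lemma computable_mem {A : Type} {B : eqType} {eA : encodable A}
    {eB : encodable B} (f : A -> B) (l : A -> seq B) :
  computable f -> computable l -> computable (fun a => f a \in l a).
Proof.
move=> cf cl; apply: (@eq_computable _ _ _ _
  (fun a => foldr (fun x r => (f a == x) || r) false (l a))).
  by move=> a; elim: (l a) => //= x s ->.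
apply: (computable_foldr (i := fun=> false)
  (g := fun q : bool * B * A => (f q.2 == q.1.2) || q.1.1)) => //.
  by computability.
apply: computable_if; [apply: computable_eq| |]; try by computability.
by apply: (computable_comp (g := f)) => //; computability.
Qed.

Local Arguments Cantor.to_nat : simpl never.
Local Arguments Cantor.of_nat : simpl never.

(** * Structural recursion on terms, carried out on their codes *)

Section TermFold.
Context {R : Type} {eR : encodable R}.
Variables (fvar : nat -> R) (one : R) (fmul : R * R -> R).
Variables (fstar fplus fmax : R -> R).

Fixpoint term_fold (t : term nat) : R :=
  match t with
  | TVar x => fvar x
  | TOne => one
  | TMul u v => fmul (term_fold u, term_fold v)
  | TStar u => fstar (term_fold u)
  | TPlus u => fplus (term_fold u)
  | TMax u => fmax (term_fold u)
  end.

(* Course-of-values recursion: subterms have smaller codes. *)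
Lemma computable_term_fold :
  computable fvar -> computable fmul -> computable fstar -> computable fplus ->
  computable fmax -> computable term_fold.
Proof.
move=> [V rV hV] [M rM hM] [S rS hS] [P rP hP] [X rX hX].
(* A history of length n lists the values at n - 1, ..., 0, most recent first, so the value at k
   sits at position n - (k + 1). *)
pose get (q : nat * seq nat) := nth 0 q.2 (size q.2 - q.1.+1).
(* The length of the history is the number under treatment; its two Cantor components are the
   constructor tag and the payload. Tags above 5 code no term and fall into the last case. *)
pose G (h : seq nat) :=
  let p := Cantor.of_nat (size h) in
  let q := Cantor.of_nat p.2 in
  if p.1 == 0 then V p.2 else
  if p.1 == 1 then @encode R eR one else
  if p.1 == 2 then M (Cantor.to_nat (get (q.1, h), get (q.2, h))) else
  if p.1 == 3 then S (get (p.2, h)) else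
  if p.1 == 4 then P (get (p.2, h)) else X (get (p.2, h)).
pose hist n := iter n (fun h => G h :: h) [::].
have sz n : size (hist n) = n by elim: n => //= n ->.
have getE n k : k < n -> get (k, hist n) = G (hist k).
  rewrite /get /= sz; elim: n => // n IH; rewrite ltnS leq_eqVlt subSS.
  case/orP=> [/eqP->|kn]; first by rewrite subnn.
  by rewrite -IH // -subnSK.
have cG : computable G.
  have cn F : recursive (fun v : 1.-tuple nat => F (thead v)) ->
    computable (F : nat -> nat) by move=> rF; exists F.
  have cget (f : seq nat -> nat) :
      computable f -> computable (fun h => get (f h, h)).
    move=> cf; apply: computable_nth; first by computability.
    apply: computable_sub; last exact: computable_succ.
    by apply: computable_size; computability.
  have cp : computable (fun h : seq nat => Cantor.of_nat (size h)).
    by apply/computable_unpair/computable_size; computability.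
  have cp1 := computable_fst cp; have cp2 := computable_snd cp.
  have cq := computable_unpair cp2.
  have ceq i : computable (fun h : seq nat => (Cantor.of_nat (size h)).1 == i).
    by apply: computable_eq => //; computability.
  rewrite /G.
  apply: computable_if => //; first exact: (computable_comp (cn _ rV)).
  apply: computable_if => //; first exact: computable_const.
  apply: computable_if => //.
    apply: (computable_comp (cn _ rM)).
    apply: (computable_encode
      (f := fun h : seq nat => (get (_, h), get (_, h)))).
    by apply: computable_pair; apply: cget; computability.
  apply: computable_if => //; first exact/(computable_comp (cn _ rS))/cget.
  apply: computable_if => //; first exact/(computable_comp (cn _ rP))/cget.
  exact/(computable_comp (cn _ rX))/cget.
have [F rF hF] : computable (fun n : nat => G (hist n)).
  apply: (computable_comp cG).
  apply: (computable_iter (g := fun q : seq nat * nat => G q.1 :: q.1));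
    try by computability.
  apply: computable_cons; last by computability.
  by apply: (computable_comp cG); computability.
exists F => // t; rewrite [LHS]hF /=.
(* A positive tag makes the payload strictly smaller than the code, and every constructor with
   subterms has one; hence the values of the subterms are in the history. *)
have lt_pair a b : b < Cantor.to_nat (a.+1, b).
  by rewrite cantor_pairE addnS triangleS; lia.
have le1 a b : a <= Cantor.to_nat (a, b).
  by rewrite cantor_pairE; have := leq_triangle (b + a); lia.
have le2 a b : b <= Cantor.to_nat (a, b) by exact: leq_addr.
elim: t => [n||u IHu v IHv|u IHu|u IHu|u IHu];
  rewrite /G sz Cantor.cancel_of_to /=.
- exact: hV.
- by [].
- rewrite Cantor.cancel_of_to /= !getE ?IHu ?IHv; first exact: (hM (_, _)).
    exact: leq_ltn_trans (le2 _ _) (lt_pair _ _).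
  exact: leq_ltn_trans (le1 _ _) (lt_pair _ _).
- by rewrite getE ?IHu.
- by rewrite getE ?IHu.
- by rewrite getE ?IHu.
Qed.
End TermFold.

(** * Munn trees of terms *)

(* A reduced word over signed letters is a vertex of the Cayley graph of the
   free group; the edge (g, (x, b)) starts at g and is labelled x if b is true
   and x^m otherwise. *)
Notation letter := (nat * bool)%type.
Notation edge := (seq letter * (nat * bool))%type.

(** Left multiplication by a signed letter in the free group, on reduced words; the sign [true]
    stands for the letter and [false] for its inverse. *)
Definition push (l : letter) (g : seq letter) : seq letter :=
  if g is l' :: g' then if l' == (l.1, ~~ l.2) then g' else l :: g else [:: l].

Definition shift (l : letter) (A : seq edge) : seq edge :=
  [seq (push l e.1, e.2) | e <- A].

Definition shiftw (w : seq nat) (A : seq edge) : seq edge :=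
  foldr (fun x B => shift (x, true) B) A w.

(** Translation by the inverse of [w] removes the first letter of [w] first, hence a left fold. *)
Definition unshiftw (w : seq nat) (A : seq edge) : seq edge :=
  foldl (fun B x => shift (x, false) B) A w.

Definition path_edges (w : seq nat) : seq edge :=
  foldr (fun x B => ([::], (x, false)) :: shift (x, true) B) [::] w.

(** A letter x contributes the edge of x^m besides its own because x lies below x^m; this starts the
    invariant [path_edges_sub_munn]. *)
Definition munn : term nat -> seq nat * seq edge :=
  term_fold
    (fun x => ([:: x], [:: ([::], (x, false)); ([::], (x, true))]))
    ([::], [::])
    (fun q => (q.1.1 ++ q.2.1, q.1.2 ++ shiftw q.1.1 q.2.2))
    (fun q => ([::], unshiftw q.1 q.2))
    (fun q => ([::], q.2))
    (fun q => (q.1, path_edges q.1)).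

(** The lists represent sets and may repeat or permute edges, hence mutual inclusion. *)
Definition same_munn (p q : seq nat * seq edge) : bool :=
  (p.1 == q.1) &&
  (all (fun e => e \in q.2) p.2 && all (fun e => e \in p.2) q.2).

Lemma computable_push {A : Type} {eA : encodable A} (l : A -> letter)
    (g : A -> seq letter) :
  computable l -> computable g -> computable (fun a => push (l a) (g a)).
Proof.
move=> cl cg; apply: (computable_seq_case
  (g := fun q : letter * seq letter * A =>
  if q.1.1 == ((l q.2).1, ~~ (l q.2).2) then q.1.2 else l q.2 :: g q.2)) => //.
  by computability.
have cl2 : computable (fun q : letter * seq letter * A => l q.2).
  by apply: (computable_comp (g := l)) => //; computability.
apply: computable_if; first apply: computable_eq; try by computability.
  apply: computable_pair; first by computability.
  apply: (computable_if (f := fun=> false) (g := fun=> true)); by computability.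
apply: computable_cons => //.
by apply: (computable_comp (g := g)) => //; computability.
Qed.

Lemma computable_shift {A : Type} {eA : encodable A} (l : A -> letter)
    (B : A -> seq edge) :
  computable l -> computable B -> computable (fun a => shift (l a) (B a)).
Proof.
move=> cl cB; apply: (computable_map
  (g := fun q : edge * A => (push (l q.2) q.1.1, q.1.2))) => //.
apply: computable_pair; last by computability.
apply: computable_push; last by computability.
by apply: (computable_comp (g := l)) => //; computability.
Qed.

Lemma computable_munn : computable munn.
Proof.
apply: computable_term_fold; try by computability.
- apply: computable_pair; first by apply: computable_cat; computability.
  apply: computable_cat; first by computability.
  apply: (computable_foldr (l := fun q => q.1.1) (i := fun q => q.2.2)
    (g := fun r : seq edge * nat * _ => shift (r.1.2, true) r.1.1));
    try by computability.
  by apply: computable_shift; computability.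
- apply: computable_pair; first by computability.
  apply: (computable_foldl (l := fun q => q.1) (i := fun q => q.2)
    (g := fun r : seq edge * nat * _ => shift (r.1.2, false) r.1.1));
    try by computability.
  by apply: computable_shift; computability.
- apply: computable_pair; first by computability.
  apply: (computable_foldr (l := fun q => q.1) (i := fun=> [::])
    (g := fun r : seq edge * nat * (seq nat * seq edge) =>
      ([::], (r.1.2, false)) :: shift (r.1.2, true) r.1.1));
    try by computability.
  apply: computable_cons; first by computability.
  by apply: computable_shift; computability.
Qed.

Lemma computable_same_munn :
  computable (fun q : term nat * term nat => same_munn (munn q.1) (munn q.2)).
Proof.
have c1 : computable (fun q : term nat * term nat => munn q.1).
  by apply: (computable_comp computable_munn); computability.
have c2 : computable (fun q : term nat * term nat => munn q.2).
  by apply: (computable_comp computable_munn); computability.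
apply: computable_andb; first by apply: computable_eq; computability.
apply: computable_andb.
  apply: (computable_all (l := fun q => (munn q.1).2)
    (p := fun r : edge * (term nat * term nat) => r.1 \in (munn r.2.2).2));
    first by computability.
  apply: computable_mem; computability.
  by apply: (computable_comp (g := fun q => munn q.2)) => //; computability.
apply: (computable_all (l := fun q => (munn q.2).2)
  (p := fun r : edge * (term nat * term nat) => r.1 \in (munn r.2.1).2));
  first by computability.
apply: computable_mem; computability.
by apply: (computable_comp (g := fun q => munn q.1)) => //; computability.
Qed.

(** * Values of Munn trees in a perfect F-birestriction monoid *)

Local Open Scope group_scope.

Section Projections.
Variable S : birestrictionMonoidType.
Implicit Types x y e f : S.

Lemma is_projection_star x : is_projection (star x).
Proof. by exists x. Qed.

Lemma is_projection_plus x : is_projection (plus x).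
Proof. by apply/projection_plus; exists x. Qed.

Lemma star_projection e : is_projection e -> star e = e.
Proof. by move=> [x ->]; rewrite star_star. Qed.

Lemma plus_projection e : is_projection e -> plus e = e.
Proof. by move=> [x ->]; rewrite plus_star. Qed.

Lemma projectionxx e : is_projection e -> e * e = e.
Proof. by move=> [x ->]; rewrite starxx. Qed.

Lemma projectionC e f : is_projection e -> is_projection f -> e * f = f * e.
Proof. by move=> [x ->] [y ->]; rewrite starC. Qed.

Lemma projectionM e f :
  is_projection e -> is_projection f -> is_projection (e * f).
Proof.
by move=> [x ->] [y ->]; exists (x * star y); rewrite star_mul_star.
Qed.

Lemma plus1 : plus (1 : S) = 1.
Proof. by have := plus_mul (1 : S); rewrite mulg1. Qed.

Lemma is_projection1 : is_projection (1 : S).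
Proof. by rewrite -plus1; exact: is_projection_plus. Qed.

(** By the ample identity the left side is [plus (x * y) * plus x], and the second factor is
    absorbed. This and its dual [star_starM] merge successive actions of letters into the action of
    a product. *)
Lemma plusM_plus x y : plus (x * plus y) = plus (x * y).
Proof.
by rewrite plus_ample plus_plus_mul plusC -plus_plus_mul mulgA plus_mul.
Qed.

Lemma star_starM x y : star (star x * y) = star (x * y).
Proof.
by rewrite star_ample star_mul_star starC -star_mul_star -mulgA mul_star.
Qed.
End Projections.

Lemma smax1 (S : fBirestrictionMonoidType) : smax (1 : S) = 1.
Proof. by have := plus_mul_smax (1 : S); rewrite plus1 mul1g. Qed.

Lemma smax_star (S : fBirestrictionMonoidType) (x : S) : smax (star x) = 1.
Proof. by rewrite -[star x]mul1g smaxMstar smax1. Qed.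

Lemma smax_plus (S : fBirestrictionMonoidType) (x : S) : smax (plus x) = 1.
Proof. by rewrite -star_plus smax_star. Qed.

Lemma smax_smax (S : fBirestrictionMonoidType) (x : S) :
  smax (smax x) = smax x.
Proof. exact: sigma_smax (smaxP x).1. Qed.

(** * Reduced words and translation of edge lists *)

Definition reduced (g : seq letter) : bool :=
  sorted (fun l l' : letter => l' != (l.1, ~~ l.2)) g.

Lemma reduced_push l g : reduced g -> reduced (push l g).
Proof.
case: g => // l' g rg; rewrite /push; case: eqP => [_|/eqP ne].
  exact: path_sorted rg.
by rewrite /reduced /= ne.
Qed.

(** If the first [push] adds a letter, the second cancels it. If it cancels the head of [g],
    reducedness prevents the next letter from cancelling when the head is put back. *)
Lemma pushK x b g : reduced g -> push (x, ~~ b) (push (x, b) g) = g.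
Proof.
case: g => [|l' g] rg; first by rewrite /push /= negbK eqxx.
rewrite {2}/push; case: eqP => [e|_]; last by rewrite /push /= negbK eqxx.
case: g rg => [|l g]; rewrite e //= => /andP[+ _].
by rewrite /push => /negPf ->.
Qed.

Lemma path_edges_cat w v :
  path_edges (w ++ v) = path_edges w ++ shiftw w (path_edges v).
Proof. by elim: w => //= x w ->; rewrite /shift map_cat. Qed.

Lemma shift_sub l (A B : seq edge) :
  {subset A <= B} -> {subset shift l A <= shift l B}.
Proof. by move=> sAB _ /mapP[a /sAB aB ->]; exact: map_f. Qed.

Lemma shiftw_sub w (A B : seq edge) :
  {subset A <= B} -> {subset shiftw w A <= shiftw w B}.
Proof. by move=> sAB; elim: w => //= x w; exact: shift_sub. Qed.

Lemma reduced_shift l (A : seq edge) :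
  {in A, forall a, reduced a.1} -> {in shift l A, forall a, reduced a.1}.
Proof. by move=> rA _ /mapP[a /rA ra ->]; exact: reduced_push. Qed.

Lemma reduced_path_edges w : {in path_edges w, forall a, reduced a.1}.
Proof.
elim: w => //= x w IH a; rewrite inE => /predU1P[->//|].
exact: reduced_shift.
Qed.

(** The tree-side form of x <= x^m. It lets path factors be absorbed in products and makes
    translation back along the word compatible with the action. *)
Lemma path_edges_sub_munn t : {subset path_edges (munn t).1 <= (munn t).2}.
Proof.
elim: t => //= [x|u IHu v IHv|u _] a //.
  by rewrite !inE => ->.
rewrite path_edges_cat !mem_cat => /orP[/IHu->//|].
by move=> /(shiftw_sub IHv) ->; rewrite orbT.
Qed.

(** * Action of signed letters on projections, and values of edges *)

Section Evaluation.
Variables (S : perfectFBirestrictionMonoidType) (rho : nat -> S).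
Implicit Types (l : letter) (g : seq letter) (e f : S) (A B : seq edge).

(* The partial action of a signed letter on the projections. *)
Definition act l e : S :=
  if l.2 then plus (smax (rho l.1) * e) else star (e * smax (rho l.1)).

Definition edge_value (a : edge) : S :=
  foldr act (plus (if a.2.2 then rho a.2.1 else smax (rho a.2.1))) a.1.

Definition edges_value A : S := foldr (fun a e => edge_value a * e) 1 A.

Lemma is_projection_act l e : is_projection (act l e).
Proof.
by rewrite /act; case: l.2;
  [exact: is_projection_plus | exact: is_projection_star].
Qed.

Lemma is_projection_edge a : is_projection (edge_value a).
Proof.
case: a => [[|l g] [x b]]; last exact: is_projection_act.
exact: is_projection_plus.
Qed.

Lemma is_projection_edges A : is_projection (edges_value A).
Proof.
elim: A => [|a A IH] /=; first exact: is_projection1.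
by apply: projectionM => //; exact: is_projection_edge.
Qed.

Hint Resolve is_projection_act is_projection_edge is_projection_edges : core.
Hint Resolve is_projection1 : core.

(** The ample identity moves one projection across [m], after which [plus_plus_mul] or
    [star_mul_star] splits the product. *)
Lemma actM l e f : is_projection e -> is_projection f ->
  act l (e * f) = act l e * act l f.
Proof.
move=> pe pf; rewrite /act; case: l.2; set m := smax _.
  rewrite mulgA -{1}(plus_projection pe) plus_ample -mulgA.
  by rewrite plus_plus_mul.
rewrite -mulgA -{1}(star_projection pf) star_ample mulgA.
by rewrite star_mul_star.
Qed.

Lemma act_le l e : is_projection e -> act l 1 * act l e = act l e.
Proof. by move=> pe; rewrite -actM // mul1g. Qed.

(** Opposite signs act as mutually inverse partial maps, so the composite is a restriction. For [b]
    true, the ample identity gives [m * star (e * m) = e * m], whose plus is [e * plus m]; the other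
    sign is dual. *)
Lemma actK x b e : is_projection e ->
  act (x, b) (act (x, ~~ b) e) = act (x, b) 1 * e.
Proof.
move=> pe; rewrite /act; case: b => /=; set m := smax _; rewrite ?mul1g ?mulg1.
  rewrite -star_ample (star_projection pe) -{1}(plus_projection pe).
  by rewrite plus_plus_mul (plus_projection pe) projectionC //;
     exact: is_projection_plus.
rewrite -plus_ample (plus_projection pe) -{1}(star_projection pe).
by rewrite star_mul_star (star_projection pe).
Qed.

(** Without cancellation the two projections agree by definition; when [push] cancels, [actK] brings
    in the factor [act l 1]. *)
Lemma act_edge l g xb :
  act l 1 * act l (edge_value (g, xb)) = act l 1 * edge_value (push l g, xb).
Proof.
case: g => [|l' g]; rewrite //=; case: eqP => [->|_] //.
  case: l => x b; rewrite [edge_value (_ :: _, _)]/edge_value /=.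
  by rewrite -/(edge_value (g, xb)) actK // mulgA projectionxx.
Qed.

Lemma act_edges l A : act l (edges_value A) = act l 1 * edges_value (shift l A).
Proof.
elim: A => [|[g xb] A IH] /=; first by rewrite mulg1.
by rewrite actM // IH mulgA (projectionC (e := act l _)) // act_edge -mulgA.
Qed.

Lemma edge_value_absorb a A :
  a \in A -> edge_value a * edges_value A = edges_value A.
Proof.
elim: A => //= b A IH; rewrite inE => /predU1P[->|/IH h].
  by rewrite mulgA projectionxx.
by rewrite mulgA (projectionC (is_projection_edge a)) // -mulgA h.
Qed.

(** Projections are commuting idempotents, so more edges give a smaller product, and the value
    depends only on the set of edges. *)
Lemma edges_value_absorb A B :
  {subset A <= B} -> edges_value A * edges_value B = edges_value B.
Proof.
elim: A => [|a A IH] sAB /=; first by rewrite mul1g.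
rewrite -mulgA IH ?edge_value_absorb //; first exact/sAB/mem_head.
by move=> b bA; apply: sAB; rewrite inE bA orbT.
Qed.

Lemma edges_value_cat A B :
  edges_value (A ++ B) = edges_value A * edges_value B.
Proof. by elim: A => [|a A IH] /=; rewrite ?mul1g // IH mulgA. Qed.

Definition actw (w : seq nat) e := foldr (fun x => act (x, true)) e w.
Definition unactw (w : seq nat) e := foldl (fun e x => act (x, false) e) e w.
Definition word_value (w : seq nat) : S :=
  foldr (fun x m => smax (rho x) * m) 1 w.

Lemma actwE w e : is_projection e -> actw w e = plus (word_value w * e).
Proof.
move=> pe; elim: w => [|x w /= ->]; first by rewrite /= mul1g plus_projection.
by rewrite /act /= plusM_plus mulgA.
Qed.

Lemma unactwE w e : is_projection e -> unactw w e = star (e * word_value w).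
Proof.
elim: w e => [|x w IH] e pe /=; first by rewrite mulg1 star_projection.
by rewrite IH // /act /= star_starM mulgA.
Qed.

Lemma word_value_cat w v : word_value (w ++ v) = word_value w * word_value v.
Proof. by elim: w => [|x w /= ->]; rewrite ?mul1g // mulgA. Qed.

Lemma is_projection_actw w e : is_projection e -> is_projection (actw w e).
Proof. by case: w => //= x w _; exact: is_projection_act. Qed.

Hint Resolve is_projection_actw : core.

Lemma actw_edges w A :
  actw w (edges_value A) = actw w 1 * edges_value (shiftw w A).
Proof.
elim: w => [|x w IH] /=; first by rewrite mul1g.
rewrite IH actM ?act_edges //; last exact: is_projection_actw.
(* The factor [act (x, true) 1] contributed by the new letter lies above [act (x, true) (actw w 1)]
   and is absorbed. *)
rewrite mulgA; congr (_ * _); rewrite projectionC // act_le //.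
exact: is_projection_actw.
Qed.

Lemma actw1 w : actw w 1 = edges_value (path_edges w).
Proof.
elim: w => [|x w /= ->] //=; rewrite act_edges; congr (_ * _).
by rewrite /act /= mulg1.
Qed.
(** Each letter x of [w] contributes the extra factor [act (x, false) 1]. It disappears because the
    translated edge set contains an edge with that value, namely the image of the first edge of the
    path. *)
Lemma unactw_edges w A : {subset path_edges w <= A} ->
  unactw w (edges_value A) = edges_value (unshiftw w A).
Proof.
elim: w A => //= x w IH A sA; rewrite -IH.
  congr unactw; rewrite act_edges.
  (* The edge labelled x^m that ends at the root has value [star (plus m * m) = star m], where m is
     x^m. *)
  have <- : edge_value ([:: (x, false)], (x, false)) = act (x, false) 1.
    by rewrite /edge_value /act /= plus_mul mul1g.
  rewrite edge_value_absorb //.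
  by apply/mapP; exists ([::], (x, false)) => //; exact/sA/mem_head.
(* After translation by the inverse of x, the rest of the path starts at the root and is still
   contained in the edge set. *)
move=> [g xb] ap; apply/mapP; exists (push (x, true) g, xb).
  by apply: sA; rewrite inE; apply/orP; right; exact: (map_f _ ap).
by rewrite (@pushK x true) //; exact: (reduced_path_edges ap).
Qed.

(** Since a = a^+ a^m, these two components determine the value of a term. *)
Lemma plus_smax_teval t :
  plus (teval rho t) = edges_value (munn t).2 /\
  smax (teval rho t) = word_value (munn t).1.
Proof.
have valE (a : S) : a = plus a * smax a by rewrite plus_mul_smax.
elim: t => [x||u [pu mu] v [pv mv]|u [pu mu]|u [pu mu]|u [pu mu]] /=.
- rewrite /edge_value /= !mulg1; split=> //.
  by rewrite -{1}(plus_mul_smax (rho x)) plus_plus_mul plusC.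
- by rewrite plus1 smax1.
- rewrite -smaxM mu mv word_value_cat edges_value_cat; split=> //.
  (* With s and t the two factors, (st)^+ = s^+ (s^m t^+)^+. The second factor is the word of s
     acting on the edges of t; it equals the translated edges times the path of that word, which s^+
     absorbs. *)
  rewrite (valE (teval rho u)) -plusM_plus pu pv mu -mulgA.
  rewrite -{1}(plus_projection (is_projection_edges _)) plus_plus_mul.
  rewrite -actwE // actw_edges mulgA actw1 (plus_projection _) //.
  rewrite [_ * edges_value (path_edges _)]projectionC //.
  by rewrite (edges_value_absorb (@path_edges_sub_munn u)).
- rewrite plus_star smax_star; split=> //.
  rewrite (valE (teval rho u)) pu mu -unactwE // unactw_edges //.
  exact: path_edges_sub_munn.
- by rewrite plus_projection ?smax_plus //; exact: is_projection_plus.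
- by rewrite smax_smax mu -actw1 actwE // mulg1.
Qed.
End Evaluation.

Lemma same_munn_identity (u v : term nat) :
  same_munn (munn u) (munn v) -> identity_holds u v.
Proof.
move=> /and3P[/eqP ew /allP suv /allP svu] S rho.
have [pu mu] := plus_smax_teval rho u; have [pv mv] := plus_smax_teval rho v.
rewrite -[LHS]plus_mul_smax -[RHS]plus_mul_smax pu pv mu mv ew.
congr (_ * _); rewrite -[RHS](edges_value_absorb rho suv).
by rewrite projectionC ?edges_value_absorb //; exact: is_projection_edges.
Qed.

(** * The monoid of edge sets *)

Local Open Scope group_scope.
Local Open Scope classical_set_scope.

(** On reduced words every signed letter acts as a permutation, so translations of edge sets are
    invertible. *)
Definition vertex := {g : seq letter | reduced g}.

Definition vpush (l : letter) (g : vertex) : vertex :=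
  exist _ (push l (sval g)) (reduced_push l (svalP g)).

Lemma vpushK x b g : vpush (x, ~~ b) (vpush (x, b) g) = g.
Proof. by apply: val_inj; apply: pushK; exact: (svalP g). Qed.

Lemma reduced_nil : reduced [::].
Proof. by []. Qed.

Definition base_edge (xb : nat * bool) : vertex * (nat * bool) :=
  (exist _ [::] reduced_nil, xb).

Definition edge_set := set (vertex * (nat * bool)).

(** The image under [l], written as a preimage under the inverse letter so that it commutes with
    unions by conversion. *)
Definition translate (l : letter) (A : edge_set) : edge_set :=
  fun e => A (vpush (l.1, ~~ l.2) e.1, e.2).

Lemma translateK x b A : translate (x, b) (translate (x, ~~ b) A) = A.
Proof.
apply/funext => -[g xb]; rewrite /translate /= -{2}[g](vpushK x (~~ b)).
by rewrite !negbK.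
Qed.

Lemma translateU l A B :
  translate l (A `|` B) = translate l A `|` translate l B.
Proof. by []. Qed.

Definition translatew (w : seq nat) (A : edge_set) : edge_set :=
  foldr (fun x B => translate (x, true) B) A w.

Definition untranslatew (w : seq nat) (A : edge_set) : edge_set :=
  foldl (fun B x => translate (x, false) B) A w.

Lemma translatewU w A B :
  translatew w (A `|` B) = translatew w A `|` translatew w B.
Proof. by elim: w => //= x w ->. Qed.

Lemma untranslatewU w A B :
  untranslatew w (A `|` B) = untranslatew w A `|` untranslatew w B.
Proof. by elim: w A B => //= x w IH A B; rewrite translateU IH. Qed.

Lemma translatewK w A : untranslatew w (translatew w A) = A.
Proof. by elim: w => //= x w IH; rewrite (@translateK x false). Qed.

Lemma untranslatewK w A : translatew w (untranslatew w A) = A.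
Proof. by elim: w A => //= x w IH A; rewrite IH (@translateK x true). Qed.

Lemma translatew_cat w v A :
  translatew (w ++ v) A = translatew w (translatew v A).
Proof. by rewrite /translatew foldr_cat. Qed.

Lemma untranslatew_cat w v A :
  untranslatew (w ++ v) A = untranslatew v (untranslatew w A).
Proof. by rewrite /untranslatew foldl_cat. Qed.

Definition path_set (w : seq nat) : edge_set :=
  foldr (fun x B => [set base_edge (x, false)] `|` translate (x, true) B)
    set0 w.

Lemma path_set_cat w v :
  path_set (w ++ v) = path_set w `|` translatew w (path_set v).
Proof. by elim: w => [|x w /= ->]; rewrite ?set0U // translateU setUA. Qed.

(* Larger than the free algebra: edge sets may be infinite or disconnected. *)
Definition munn_model :=
  {p : edge_set * seq nat | path_set p.2 `|` p.1 = p.1}.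

HB.instance Definition _ := gen_eqMixin munn_model.
HB.instance Definition _ := gen_choiceMixin munn_model.

Lemma munn_model_eq (x y : munn_model) : sval x = sval y -> x = y.
Proof.
by case: x y => [p hp] [q hq] /= e; subst q; rewrite (Prop_irrelevance hp hq).
Qed.

Fact model_one_subproof : path_set [::] `|` set0 = set0.
Proof. exact: set0U. Qed.

Definition model_one : munn_model := exist _ (set0, [::]) model_one_subproof.

Fact model_mul_subproof (x y : munn_model) :
  let w := (sval x).2 ++ (sval y).2 in
  let A := (sval x).1 `|` translatew (sval x).2 (sval y).1 in
  path_set w `|` A = A.
Proof.
case: x y => [[A w] /= hA] [[B v] /= hB].
by rewrite path_set_cat setUACA hA -translatewU hB.
Qed.

Definition model_mul (x y : munn_model) : munn_model :=
  exist _
    ((sval x).1 `|` translatew (sval x).2 (sval y).1, (sval x).2 ++ (sval y).2)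
    (model_mul_subproof x y).

Fact model_projection_subproof (A : edge_set) : path_set [::] `|` A = A.
Proof. exact: set0U. Qed.

Definition model_projection (A : edge_set) : munn_model :=
  exist _ (A, [::]) (model_projection_subproof A).

Definition model_star (x : munn_model) :=
  model_projection (untranslatew (sval x).2 (sval x).1).

Definition model_plus (x : munn_model) := model_projection (sval x).1.

Fact model_smax_subproof (w : seq nat) :
  path_set w `|` path_set w = path_set w.
Proof. exact: setUid. Qed.

Definition model_word (w : seq nat) : munn_model :=
  exist _ (path_set w, w) (model_smax_subproof w).

Definition model_smax (x : munn_model) := model_word (sval x).2.

Fact model_mulA : associative model_mul.
Proof.
move=> x y z; apply: munn_model_eq; congr (_, _); last exact: catA.
by rewrite /= translatew_cat translatewU setUA.
Qed.

Fact model_mul1 : left_id model_one model_mul.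
Proof.
by move=> x; apply: munn_model_eq; rewrite /= set0U -surjective_pairing.
Qed.

Fact model_mulr1 : right_id model_one model_mul.
Proof.
move=> [[A w] hA]; apply: munn_model_eq; rewrite /= cats0; congr (_, _).
suff -> : translatew w set0 = set0 by rewrite setU0.
by elim: w {hA} => //= x w ->.
Qed.

HB.instance Definition _ :=
  isMonoid.Build munn_model model_mulA model_mul1 model_mulr1.

Fact model_mul_star x : model_mul x (model_star x) = x.
Proof.
apply: munn_model_eq; rewrite /= cats0 untranslatewK setUid.
by rewrite -surjective_pairing.
Qed.

Fact model_starC x y : model_mul (model_star x) (model_star y) =
  model_mul (model_star y) (model_star x).
Proof. by apply: munn_model_eq; rewrite /= setUC. Qed.

Fact model_star_mul_star x y : model_star (model_mul x (model_star y)) =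
  model_mul (model_star x) (model_star y).
Proof. by apply: munn_model_eq; rewrite /= cats0 untranslatewU translatewK. Qed.

Fact model_star_ample x y : model_mul (model_star x) y =
  model_mul y (model_star (model_mul x y)).
Proof.
apply: munn_model_eq; rewrite /= cats0.
rewrite untranslatew_cat untranslatewK untranslatewU translatewK.
by rewrite (setUC (untranslatew _ _)) setUA setUid.
Qed.

Fact model_plus_mul x : model_mul (model_plus x) x = x.
Proof.
by apply: munn_model_eq; rewrite /= setUid -surjective_pairing.
Qed.

Fact model_plusC x y : model_mul (model_plus x) (model_plus y) =
  model_mul (model_plus y) (model_plus x).
Proof. by apply: munn_model_eq; rewrite /= setUC. Qed.

Fact model_plus_plus_mul x y : model_plus (model_mul (model_plus x) y) =
  model_mul (model_plus x) (model_plus y).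
Proof. exact: munn_model_eq. Qed.

Fact model_plus_ample x y : model_mul x (model_plus y) =
  model_mul (model_plus (model_mul x y)) x.
Proof.
by apply: munn_model_eq; rewrite /= cats0 setUAC setUid.
Qed.

Fact model_star_plus x : model_star (model_plus x) = model_plus x.
Proof. exact: munn_model_eq. Qed.

Fact model_plus_star x : model_plus (model_star x) = model_star x.
Proof. exact: munn_model_eq. Qed.

HB.instance Definition _ := Monoid_isBirestriction.Build munn_model
  model_mul_star model_starC model_star_mul_star model_star_ample
  model_plus_mul model_plusC model_plus_plus_mul model_plus_ample
  model_star_plus model_plus_star.

(** Elements related by sigma have the same word w, and every edge set paired with w contains
    [path_set w]. A smaller edge set means a larger element, so the bare path is the maximum. *)
Fact model_smaxP (x : munn_model) : is_max_of_sigma_class x (model_smax x).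
Proof.
split.
  exists (star x); first exact: is_projection_star.
  rewrite mul_star; apply: munn_model_eq.
  rewrite /= cats0 untranslatewK (svalP x).
  by rewrite -surjective_pairing.
move=> t [_ [s ->]] /(congr1 (fun z : munn_model => (sval z).2)) /=.
rewrite !cats0 => e; exists (plus t); first exact: is_projection_plus.
apply: munn_model_eq; rewrite /= -e setUC (svalP t).
by rewrite -surjective_pairing.
Qed.

HB.instance Definition _ :=
  BirestrictionMonoid_isF.Build munn_model model_smaxP.

Fact model_smaxM (x y : munn_model) :
  model_mul (model_smax x) (model_smax y) = model_smax (model_mul x y).
Proof. by apply: munn_model_eq; rewrite /= path_set_cat. Qed.

HB.instance Definition _ :=
  FBirestrictionMonoid_isPerfect.Build munn_model model_smaxM.

Fact model_gen_subproof (x : nat) :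
  let A := [set base_edge (x, false)] `|` [set base_edge (x, true)] in
  path_set [:: x] `|` A = A.
Proof.
rewrite /=; have -> : translate (x, true) set0 = set0 by [].
by rewrite setU0 setUA setUid.
Qed.

Definition model_gen (x : nat) : munn_model :=
  exist _ ([set base_edge (x, false)] `|` [set base_edge (x, true)], [:: x])
    (model_gen_subproof x).

(** * Comparison of computed edge lists with edge sets *)

Definition edge_set_of (A : seq edge) : edge_set :=
  fun e => (sval e.1, e.2) \in A.

Lemma edge_set_of_cat A B :
  edge_set_of (A ++ B) = edge_set_of A `|` edge_set_of B.
Proof.
by apply/funext => e; rewrite /edge_set_of mem_cat; apply/propext; split=> /orP.
Qed.

(** The list is translated by taking images, the set by taking preimages; these agree because [push]
    is invertible on reduced words. *)
Lemma edge_set_of_shift l A : {in A, forall a, reduced a.1} ->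
  edge_set_of (shift l A) = translate l (edge_set_of A).
Proof.
case: l => x b rA; apply/funext => -[[g rg] xb]; apply/propext; split.
  move=> /mapP[[h yc] hA [/= eg ->]]; rewrite /translate /edge_set_of /=.
  by rewrite eg pushK //; exact: (rA _ hA).
move=> h; apply/mapP; eexists; first exact: h.
by have /= := pushK x (~~ b) rg; rewrite negbK => ->.
Qed.

Lemma reduced_shiftw w A :
  {in A, forall a, reduced a.1} -> {in shiftw w A, forall a, reduced a.1}.
Proof. by move=> rA; elim: w => //= x w; exact: reduced_shift. Qed.

Lemma edge_set_of_shiftw w A : {in A, forall a, reduced a.1} ->
  edge_set_of (shiftw w A) = translatew w (edge_set_of A).
Proof.
move=> rA; elim: w => //= x w <-; apply: edge_set_of_shift.
exact: reduced_shiftw.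
Qed.

Lemma reduced_unshiftw w A :
  {in A, forall a, reduced a.1} -> {in unshiftw w A, forall a, reduced a.1}.
Proof. by elim: w A => //= x w IH A rA; apply/IH/reduced_shift. Qed.

Lemma edge_set_of_unshiftw w A : {in A, forall a, reduced a.1} ->
  edge_set_of (unshiftw w A) = untranslatew w (edge_set_of A).
Proof.
elim: w A => //= x w IH A rA; rewrite IH ?edge_set_of_shift //.
exact: reduced_shift.
Qed.

Lemma edge_set_of1 xb : edge_set_of [:: ([::], xb)] = [set base_edge xb].
Proof.
apply/funext => -[g yc]; rewrite /edge_set_of inE; apply/propext.
split=> [/eqP[eg ->]|-> /=] //.
by congr (_, _); exact: val_inj.
Qed.

Lemma edge_set_of_path w : edge_set_of (path_edges w) = path_set w.
Proof.
elim: w => [|x w /= <-].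
  by apply/funext => e; apply/propext; rewrite /edge_set_of /=; split.
rewrite -[_ :: shift _ _]cat1s edge_set_of_cat edge_set_of1.
by rewrite edge_set_of_shift //; exact: reduced_path_edges.
Qed.

Lemma reduced_munn t : {in (munn t).2, forall a, reduced a.1}.
Proof.
elim: t => //= [x|u IHu v IHv|u IHu|u _] a.
- by rewrite !inE => /orP[] /eqP ->.
- by rewrite mem_cat => /orP[/IHu|/(reduced_shiftw IHv)].
- exact: reduced_unshiftw.
- exact: reduced_path_edges.
Qed.

Lemma teval_model_gen t :
  sval (teval model_gen t) = (edge_set_of (munn t).2, (munn t).1).
Proof.
elim: t => [x||u IHu v IHv|u IHu|u IHu|u IHu] /=; rewrite ?IHu ?IHv /=.
- by rewrite -[[:: _; _]]cat1s edge_set_of_cat !edge_set_of1.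
- by congr (_, _); apply/funext => e; apply/propext; split.
- rewrite edge_set_of_cat edge_set_of_shiftw //; exact: reduced_munn.
- by rewrite edge_set_of_unshiftw //; exact: reduced_munn.
- by [].
- by rewrite edge_set_of_path.
Qed.

Lemma identity_same_munn (u v : term nat) :
  identity_holds u v -> same_munn (munn u) (munn v).
Proof.
move=> /(_ _ model_gen)/(congr1 sval); rewrite !teval_model_gen => -[eA ew].
have sub s t : edge_set_of (munn s).2 = edge_set_of (munn t).2 ->
    all (fun e => e \in (munn t).2) (munn s).2.
  (* Listed edges start at reduced words, so each is a point of the model at which the equality of
     sets can be evaluated. *)
  move=> e; apply/allP => -[g xb] gs.
  have := congr1 (fun A : edge_set => A (exist _ g (reduced_munn gs), xb)) e.
  by rewrite /edge_set_of /= gs => <-.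
by rewrite /same_munn ew eqxx !sub.
Qed.

(** * Decidability *)

Local Close Scope classical_set_scope.
Local Close Scope group_scope.

Lemma identity_same_munnP (u v : term nat) :
  identity_holds u v <-> same_munn (munn u) (munn v).
Proof. by split; [exact: identity_same_munn | exact: same_munn_identity]. Qed.

Lemma teval_term_map (X Y : Type) (f : X -> Y)
    (S : perfectFBirestrictionMonoidType) (rho : Y -> S) (t : term X) :
  teval rho (term_map f t) = teval (rho \o f) t.
Proof. by elim: t => //= [u -> v ->|u ->|u ->|u ->]. Qed.

Lemma identity_holds_map (X Y : Type) (f : X -> Y) (u v : term X) :
  identity_holds u v -> identity_holds (term_map f u) (term_map f v).
Proof. by move=> h S rho; rewrite !teval_term_map; exact: h. Qed.

Lemma term_mapK (X Y : Type) (f : X -> Y) (g : Y -> X) (t : term X) :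
  (forall x, occurs x t -> g (f x) = x) -> term_map g (term_map f t) = t.
Proof.
elim: t => //= [x h|u IHu v IHv h|u IH h|u IH h|u IH h]; rewrite ?h ?IH //.
by rewrite IHu ?IHv // => x o; apply: h; [right | left].
Qed.

(** Renaming letters preserves identities. Conversely, [nu] has a left inverse on the finitely many
    letters that occur, and renaming back along it recovers [u] and [v]. *)
Lemma identity_holds_injective (X : Type) (nu : X -> nat) (u v : term X) :
  inhabited X -> injective_on_letters nu u v ->
  identity_holds (term_map nu u) (term_map nu v) <-> identity_holds u v.
Proof.
move=> [x0] inj_nu; split; last exact: identity_holds_map.
pose occ x := occurs x u \/ occurs x v.
(* The left inverse [mu] takes the default value [x0] at numbers that name no occurring letter. *)
have /choice[mu hmu] n : exists x, forall y, occ y -> nu y = n -> x = y.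
  have [[x [ox <-]]|none] := pselect (exists x, occ x /\ nu x = n).
    by exists x => y oy e; exact: inj_nu.
  by exists x0 => y oy e; case: none; exists y.
move=> /(identity_holds_map mu); rewrite !term_mapK // => x ox.
  by apply: hmu => //; right.
by apply: hmu => //; left.
Qed.

Theorem corollary11p10 (X : Type) (hX : inhabited X) :
  decidable_word_problem (@FFBRp_gen X).
Proof.
have [F rF hF] := computable_same_munn.
(* The Cantor pair of two term codes is the code of the pair of terms, on which [F] computes
   [same_munn]; the algorithm depends neither on [X] nor on [nu]. *)
exists (fun v => F (Cantor.to_nat (tnth v ord0, tnth v ord_max))).
  by apply: (recursive_comp1 rF); apply: recursive_pair; exact: rec_proj.
move=> u v nu inj_nu.
rewrite [LHS](hF (term_map nu u, term_map nu v)) /=; congr nat_of_bool.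
apply/idP/asboolP; rewrite !teval_FFBRp_gen.
  by move=> /identity_same_munnP/(identity_holds_injective hX inj_nu)/clsP.
by move=> /clsP/(identity_holds_injective hX inj_nu)/identity_same_munnP.
Qed.
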